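(* Let $q,u,v,x,y$ be indeterminates (equivalently, generic complex parameters for which no denominator below vanishes) and let $r\ge 0$ be an integer. Then $$\frac{(u;q)_r}{(q;q)_r}\ {}_2\phi_1\!\left[\begin{matrix} q^{-r},\ ux\\ q^{1-r}/ux\end{matrix};q,\frac{qv}{u^2x}\right] =\sum_{i=0}^{\lfloor r/2\rfloor}\frac{(u;q)_{r-2i}}{(q;q)_{r-2i}}\ {}_2\phi_1\!\left[\begin{matrix} q^{2i-r},\ uy\\ q^{1+2i-r}/uy\end{matrix};q,\frac{qv}{u^2y}\right]\, y^i v^i\,\frac{(x/y;q)_i}{(q;q)_i}\,\frac{(uq^{r-2i};q)_{2i}}{(uxq^{r-i};q)_i\,(uyq^{r-2i+1};q)_i}.$$
   Context: For an indeterminate $a$ and integer $k\ge 0$, $(a;q)_k=\prod_{j=0}^{k-1}(1-aq^j)$. The basic hypergeometric series is ${}_{s+1}\phi_s\!\left[\begin{matrix}a_1,\dots,a_{s+1}\\ b_1,\dots,b_s\end{matrix};q,z\right]=\sum_{i\ge0}\frac{(a_1;q)_i\cdots(a_{s+1};q)_i}{(b_1;q)_i\cdots(b_s;q)_i}\frac{z^i}{(q;q)_i}$; when some $a_j=q^{-m}$ with $m\ge0$ an integer, the series terminates at $i=m$. *)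

(* Defs.v *)
From mathcomp Require Import all_boot all_order all_algebra.
From mathcomp Require Import boolp classical_sets functions cardinality fsbigop.

Set Implicit Arguments.
Unset Strict Implicit.
Unset Printing Implicit Defensive.

Import GRing.Theory.

Local Open Scope ring_scope.
Local Open Scope classical_set_scope.

Definition qpoch (F : fieldType) (a q : F) (k : nat) : F :=
  \prod_(j < k) (1 - a * q ^+ j).

Definition qhyp_term (F : fieldType) (s : nat) (a : s.+1.-tuple F)
    (b : s.-tuple F) (q z : F) (i : nat) : F :=
  (\prod_(c <- a) qpoch c q i) / (\prod_(c <- b) qpoch c q i)
  * (z ^+ i / qpoch q q i).

(* The sum over all i >= 0 is a finitely supported one: it is the value of the
   series when the series terminates (qhyp_terminating), and is 0 by
   convention when infinitely many terms are nonzero. *)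
Definition qhyp (F : fieldType) (s : nat) (a : s.+1.-tuple F)
    (b : s.-tuple F) (q z : F) : F :=
  \sum_(i \in [set: nat]) qhyp_term a b q z i.

Lemma qpoch_terminating (F : fieldType) (q : F) (m i : nat) :
  q != 0 -> (m < i)%N -> qpoch (q ^ (- m%:Z)) q i = 0.
Proof.
move=> q0 lt_mi; rewrite /qpoch (bigD1 (Ordinal lt_mi)) //=.
by rewrite -exprnN mulVf ?expf_neq0 // subrr mul0r.
Qed.

Lemma qhyp_terminating (F : fieldType) (s : nat) (a : s.+1.-tuple F)
    (b : s.-tuple F) (q z : F) (m : nat) :
  q != 0 -> q ^ (- m%:Z) \in a ->
  qhyp a b q z = \sum_(i < m.+1) qhyp_term a b q z i.
Proof.
move=> q0 ma; rewrite /qhyp (fsbig_ord _ m.+1 (qhyp_term a b q z)).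
apply/esym/fsbig_widen => // i [_ /= /negP]; rewrite -leqNgt => lt_mi.
rewrite /preimage /= /qhyp_term (big_rem _ ma) /=.
by rewrite (qpoch_terminating q0 lt_mi) !mul0r.
Qed.

(* Main.v *)
Require Import Defs.
From mathcomp Require Import all_boot all_order all_algebra.
From mathcomp Require Import ring zify.

(** Put [a = u x], [b = u y] and [w = v / u].  Reversing the q-shifted
    factorials turns each 2phi1 into the Rogers polynomial
    [C_n(a) = \sum_k (a)_k (a)_(n-k) / ((q)_k (q)_(n-k)) w^k], and the theorem
    becomes Rogers' connection formula between [C_r(a)] and the [C_(r-2i)(b)].
    Comparing the coefficients of [w^m] with [r = m + n] leaves a terminating
    very-well-poised 6phi5 summation.  Its sum satisfies a first-order recurrence
    in [n], because the corresponding combination of summands telescopes. *)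

Set Implicit Arguments.
Unset Strict Implicit.
Unset Printing Implicit Defensive.

Import GRing.Theory.

Local Open Scope ring_scope.

(** * Reversal of q-shifted factorials, and the 2phi1 as a Rogers polynomial *)

Section QPochhammer.

Variables (F : fieldType) (q : F).
Implicit Types (a b c : F) (k l m n r : nat).

Lemma qpoch0 a : qpoch a q 0 = 1.
Proof. by rewrite /qpoch big_ord0. Qed.

Lemma qpochS a k : qpoch a q k.+1 = qpoch a q k * (1 - a * q ^+ k).
Proof. by rewrite /qpoch big_ord_recr. Qed.

Lemma qpochD a k l : qpoch a q (k + l) = qpoch a q k * qpoch (a * q ^+ k) q l.
Proof.
elim: l => [|l IHl]; first by rewrite addn0 qpoch0 mulr1.
by rewrite addnS !qpochS IHl exprD !mulrA.
Qed.

Lemma qpoch_neq0_le a k l :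
  (k <= l)%N -> qpoch a q l != 0 -> qpoch a q k != 0.
Proof. by move=> /subnKC <-; rewrite qpochD mulf_eq0 negb_or => /andP[]. Qed.

(* The factor on the right does not depend on [a], so that it cancels between
   the instances [a] and [q] of this identity. *)
Lemma qpoch_reverse a r k : q != 0 -> a != 0 -> (k <= r)%N ->
  qpoch (q ^ (1 - r%:Z) / a) q k * a ^+ k * qpoch a q (r - k)
  = (\prod_(j < k) - (q ^ (1 - r%:Z) * q ^+ j)) * qpoch a q r.
Proof.
move=> q0 a0; elim: k => [|k IHk] lt_kr.
  by rewrite qpoch0 big_ord0 expr0 subn0 !mul1r.
have := IHk (ltnW lt_kr).
rewrite big_ord_recr /= [(r - k)%N](_ : _ = (r - k.+1).+1); last by lia.
rewrite !qpochS exprSr => IH.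
set e := q ^ _ * q ^+ k; have eE : e * q ^+ (r - k.+1) = 1.
  by rewrite /e !exprnP -!expfzDr // [X in q ^ X](_ : _ = 0) ?expr0z //; lia.
transitivity (- e * (qpoch (q ^ (1 - r%:Z) / a) q k * a ^+ k *
   (qpoch a q (r - k.+1) * (1 - a * q ^+ (r - k.+1))))); last first.
  by rewrite IH; ring.
(* Since [e * q ^+ (r - k.+1) = 1], the factor gained by the reversed product is, up to [- e / a],
   the factor lost by [qpoch a q (r - k)]. *)
have -> : (1 - q ^ (1 - r%:Z) / a * q ^+ k) = - e * (1 - a * q ^+ (r - k.+1)) / a.
  transitivity ((a * (e * q ^+ (r - k.+1)) - e) / a); last by field.
  by rewrite eE /e; field.
by field.
Qed.

(** Full reversal, [k = r]: it turns the nonvanishing of the 2phi1 denominators into that of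
    [qpoch a q r]. *)
Lemma qpoch_reverse_neq0 a r : q != 0 -> a != 0 ->
  (qpoch (q ^ (1 - r%:Z) / a) q r != 0) = (qpoch a q r != 0).
Proof.
move=> q0 a0; have := qpoch_reverse q0 a0 (leqnn r).
rewrite subnn qpoch0 mulr1 => /(congr1 (fun z => z == 0)).
rewrite !mulf_eq0 expf_eq0 (negPf a0) andbF orbF => ->.
suff /negPf-> : \prod_(j < r) - (q ^ (1 - r%:Z) * q ^+ j) != 0 by [].
by apply/prodf_neq0 => j _; rewrite oppr_eq0 mulf_neq0 ?expf_neq0 ?expfz_neq0.
Qed.

Definition rogers_coef a m n : F :=
  qpoch a q m * qpoch a q n / (qpoch q q m * qpoch q q n).

(** In each term the reversal factors of [a] and [q] cancel, and the leftover [(a / q) ^+ k] is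
    absorbed by the argument [q * z / a]. *)
Lemma qhyp_rogers a z r : q != 0 -> a != 0 -> qpoch q q r != 0 ->
  qpoch a q r != 0 ->
  qhyp [tuple q ^ (- r%:Z); a] [tuple q ^ (1 - r%:Z) / a] q (q * z / a)
  = qpoch q q r / qpoch a q r
    * \sum_(k < r.+1) rogers_coef a k (r - k) * z ^+ k.
Proof.
move=> q0 a0 hq ar0; rewrite (@qhyp_terminating _ _ _ _ _ _ r) //; last first.
  by rewrite inE eqxx.
rewrite mulr_sumr; apply: eq_bigr => -[k /=]; rewrite ltnS => le_kr _.
have ark0 := qpoch_neq0_le (leq_subr k r) ar0.
have qrk0 := qpoch_neq0_le (leq_subr k r) hq.
have qk0 := qpoch_neq0_le le_kr hq.
rewrite /qhyp_term /rogers_coef !big_cons !big_nil /= !mulr1.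
have ea := qpoch_reverse q0 a0 le_kr.
have := qpoch_reverse q0 q0 le_kr.
rewrite [q ^ (1 - r%:Z) / q](_ : _ = q ^ (- r%:Z)); last first.
  by rewrite expfzDr // expr1z mulrAC divff // mul1r.
set e := \prod_(j < k) _ in ea * => eq.
have e0 : e != 0.
  apply/prodf_neq0 => j _; rewrite oppr_eq0 mulf_neq0 ?expf_neq0 //.
  exact: expfz_neq0.
have -> : qpoch (q ^ (- r%:Z)) q k
  = e * qpoch q q r / (q ^+ k * qpoch q q (r - k)).
  by rewrite -eq; field; rewrite qrk0 expf_neq0.
have -> : qpoch (q ^ (1 - r%:Z) / a) q k
  = e * qpoch a q r / (a ^+ k * qpoch a q (r - k)).
  by rewrite -ea; field; rewrite ark0 expf_neq0.
rewrite !exprMn exprVn; field.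
by rewrite qk0 qrk0 ar0 ark0 e0 !expf_neq0.
Qed.

End QPochhammer.

(** * Rogers' connection formula, coefficient by coefficient *)

Section RogersConnection.

Variables (F : fieldType) (q a b : F).
Implicit Types (i j k m n r : nat).

(** Homogeneous form of [qpoch (a / b) q i], which avoids dividing by [b]. *)
Definition homog_qpoch i : F := \prod_(j < i) (b - a * q ^+ j).

Lemma homog_qpochS i : homog_qpoch i.+1 = homog_qpoch i * (b - a * q ^+ i).
Proof. by rewrite /homog_qpoch big_ord_recr. Qed.

Lemma homog_qpochE i : b != 0 -> homog_qpoch i = b ^+ i * qpoch (a / b) q i.
Proof.
move=> b0; elim: i => [|i IHi].
  by rewrite /homog_qpoch big_ord0 qpoch0 mulr1.
by rewrite homog_qpochS IHi qpochS exprS; field.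
Qed.

(** This is [qpoch b q (k + i).+1] without the very-well-poised factor [1 - b * q ^+ k]. In this
    form the case [i = 0] makes sense even if that factor vanishes. *)
Definition vwp_denom k i : F := qpoch b q k * qpoch (b * q ^+ k.+1) q i.

Lemma vwp_denomE k i :
  vwp_denom k i * (1 - b * q ^+ k) = qpoch b q (k + i).+1.
Proof. by rewrite -addSn qpochD qpochS /vwp_denom; ring. Qed.

Lemma vwp_denomV k i : qpoch b q (k + i).+1 != 0 ->
  (vwp_denom k i)^-1 = (1 - b * q ^+ k) / qpoch b q (k + i).+1.
Proof.
rewrite -vwp_denomE mulf_eq0 negb_or => /andP[h1 h2].
by field; rewrite h1 h2.
Qed.

(** Coefficient of [w ^+ m] in the summand [i] of the connection formula for [r = m + n]. It is
    meaningful only for [i <= minn m n], because subtraction is truncated. *)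
Definition connection_term m n i : F :=
  homog_qpoch i / qpoch q q i * qpoch a q (m + n - i)
  * (vwp_denom (m + n - 2 * i) i)^-1 * rogers_coef q b (m - i) (n - i).

(** The left side tests the recurrence in [n] satisfied by [rogers_coef q a m n]; the right side is
    the telescoping certificate, checked by induction on [j]. *)
Lemma connection_term_telescope m n j :
  qpoch q q m != 0 -> qpoch q q n.+1 != 0 -> qpoch b q (m + n).+1 != 0 ->
  (j <= m)%N -> (j <= n)%N ->
  \sum_(i < j.+1) ((1 - q ^+ n.+1) * connection_term m n.+1 i
                   - (1 - a * q ^+ n) * connection_term m n i)
  = - (homog_qpoch j.+1 * q ^+ (n - j) * (1 - q ^+ (m - j))
       * qpoch a q (m + n - j)
       / (qpoch q q j * qpoch b q (m + n - j).+1)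
       * rogers_coef q b (m - j) (n - j)).
Proof.
move=> qm0 qn0 br0; elim: j => [|j IHj] lejm lejn.
  rewrite big_ord_recl big_ord0 addr0 /= /connection_term /rogers_coef /vwp_denom.
  rewrite !muln0 !subn0 addnS homog_qpochS /homog_qpoch !big_ord0 !qpoch0.
  move: qm0 qn0 br0; rewrite !qpochS !mulf_eq0 !negb_or => qm0.
  move=> /andP[qn0 qn1] /andP[br0 br1]; move: qn1 br1; rewrite exprS !exprD expr0.
  by move=> qn1 br1; field; rewrite qm0 qn0 qn1 br0 br1 oner_neq0.
rewrite big_ord_recr IHj ?(ltnW lejm) ?(ltnW lejn) //= {IHj}.
(* Removing the truncated subtractions makes the induction step a rational identity in [q ^+ j],
   [q ^+ m'] and [q ^+ n']. *)
have [m' Em] : exists m', m = (j + m').+1 by exists (m - j.+1)%N; lia.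
have [n' En] : exists n', n = (j + n').+1 by exists (n - j.+1)%N; lia.
have qj0 := qpoch_neq0_le lejm qm0.
have qn'0 : qpoch q q n'.+1 != 0 by apply: qpoch_neq0_le qn0; lia.
have qm'0 : qpoch q q m'.+1 != 0 by apply: qpoch_neq0_le qm0; lia.
have b0 : qpoch b q (m' + n' + j).+3 != 0 by apply: qpoch_neq0_le br0; lia.
have b1 : qpoch b q (m' + n' + j).+2 != 0 by apply: qpoch_neq0_le b0; lia.
rewrite {}Em {}En {qm0 qn0 br0 lejm lejn} in qj0 *.
rewrite /connection_term /rogers_coef.
have -> : ((j + m').+1 + (j + n').+2 - j.+1 = (m' + n' + j).+2)%N by lia.
have -> : ((j + m').+1 + (j + n').+2 - 2 * j.+1 = (m' + n').+1)%N by lia.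
have -> : ((j + m').+1 + (j + n').+1 - 2 * j.+1 = m' + n')%N by lia.
have -> : ((j + m').+1 + (j + n').+1 - j.+1 = (m' + n' + j).+1)%N by lia.
have -> : ((j + m').+1 + (j + n').+1 - j = (m' + n' + j).+2)%N by lia.
have -> : ((j + m').+1 - j.+1 = m')%N by lia.
have -> : ((j + n').+1 - j.+1 = n')%N by lia.
have -> : ((j + n').+2 - j.+1 = n'.+1)%N by lia.
have -> : ((j + m').+1 - j = m'.+1)%N by lia.
have -> : ((j + n').+1 - j = n'.+1)%N by lia.
rewrite !vwp_denomV ?addSn ?addnS //.
rewrite (homog_qpochS j.+1).
move: qj0 qn'0 qm'0 b0 b1; rewrite !(qpochS _ _ (_ + _).+2) !(qpochS _ _ (_ + _).+1).
rewrite !(qpochS _ _ j) !(qpochS _ _ m') !(qpochS _ _ n').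
rewrite !mulf_eq0 !negb_or !exprS !exprD.
move: (qpoch q q j) (qpoch q q m') (qpoch q q n') (qpoch b q n') (qpoch b q m').
move: (qpoch a q _) (qpoch b q _) (homog_qpoch j.+1) => A B H Qj Qm Qn Bn Bm.
move: (q ^+ m') (q ^+ n') (q ^+ j) => M N J.
move=> /andP[h1 h2] /andP[h3 h4] /andP[h5 h6] /andP[/andP[h7 h8] h9] _.
field.
by rewrite h1 h2 h3 h4 h5 h6 h7 h8 h9.
Qed.

Definition connection_sum m n : F :=
  \sum_(i < (minn m n).+1) connection_term m n i.

Lemma connection_sum_rec m n :
  qpoch q q m != 0 -> qpoch q q n.+1 != 0 -> qpoch b q (m + n).+1 != 0 ->
  (1 - q ^+ n.+1) * connection_sum m n.+1
  = (1 - a * q ^+ n) * connection_sum m n.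
Proof.
move=> qm0 qn0 br0; apply/eqP; rewrite -subr_eq0; apply/eqP.
have := connection_term_telescope qm0 qn0 br0; rewrite /connection_sum.
case: (leqP m n) => [le_mn|lt_nm] /(_ (minn m n));
  rewrite geq_minl geq_minr => /(_ isT isT).
  rewrite (minn_idPl le_mn) (minn_idPl (leqW le_mn)) sumrB -!mulr_sumr => ->.
  (* The certificate at [j = m] contains [1 - q ^+ 0]. *)
  by rewrite subnn expr0 subrr mulr0 !mul0r oppr0.
(* Here the sum for [n.+1] has one more term, [i = n.+1], which cancels the certificate at
   [j = n]. *)
rewrite (minn_idPr (ltnW lt_nm)) (minn_idPr lt_nm) sumrB -!mulr_sumr => telE.
rewrite (big_ord_recr n.+1) /= mulrDr addrAC {}telE.
have [m' Em] : exists m', m = (n + m').+1 by exists (m - n.+1)%N; lia.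
have b0 : qpoch b q (m' + n).+2 != 0 by apply: qpoch_neq0_le br0; lia.
have qm'0 : qpoch q q m'.+1 != 0 by apply: qpoch_neq0_le qm0; lia.
rewrite {}Em {lt_nm qm0 br0} /connection_term /rogers_coef.
have -> : ((n + m').+1 + n.+1 - n.+1 = (m' + n).+1)%N by lia.
have -> : ((n + m').+1 + n.+1 - 2 * n.+1 = m')%N by lia.
have -> : ((n + m').+1 + n - n = (m' + n).+1)%N by lia.
have -> : ((n + m').+1 - n.+1 = m')%N by lia.
have -> : ((n + m').+1 - n = m'.+1)%N by lia.
rewrite !subnn !vwp_denomV ?addnS // !qpoch0 !expr0.
move: qn0 qm'0 b0; rewrite !(qpochS q q) (qpochS q b m').
rewrite !mulf_eq0 !negb_or !exprS => /andP[h1 h2] /andP[h3 h4] h5.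
by field; rewrite h1 h2 h3 h4 h5.
Qed.

(** Both sides obey the same recurrence in [n], and at [n = 0] only [i = 0] remains. *)
Lemma connection_sumE m n :
  qpoch q q m != 0 -> qpoch q q n != 0 -> qpoch b q (m + n) != 0 ->
  connection_sum m n = rogers_coef q a m n.
Proof.
move=> qm0; elim: n => [|n IHn] qn0 br0.
  rewrite /connection_sum minn0 big_ord1 /connection_term /rogers_coef /vwp_denom.
  move: br0; rewrite muln0 !subn0 addn0 /homog_qpoch big_ord0 !qpoch0 => br0.
  by field; rewrite qm0 br0 oner_neq0.
rewrite addnS in br0; have := connection_sum_rec qm0 qn0 br0.
move: (qn0); rewrite qpochS mulf_eq0 negb_or -exprS => /andP[qn0' q1].
rewrite IHn //; last exact: qpoch_neq0_le br0.
move=> /(canRL (mulKf q1)) ->; rewrite /rogers_coef !qpochS -exprS.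
by field; rewrite qm0 qn0' q1.
Qed.

Lemma rogers_connection w r : qpoch q q r != 0 -> qpoch b q r != 0 ->
  \sum_(k < r.+1) rogers_coef q a k (r - k) * w ^+ k
  = \sum_(i < (r./2).+1)
      homog_qpoch i * w ^+ i / qpoch q q i * qpoch a q (r - i)
      * (vwp_denom (r - 2 * i) i)^-1
      * \sum_(k < (r - 2 * i).+1) rogers_coef q b k (r - 2 * i - k) * w ^+ k.
Proof.
move=> qr0 br0.
(* The condition encodes [i <= minn k (r - k)] with bounds independent of [k], so that the sums can
   be exchanged. *)
transitivity (\sum_(0 <= k < r.+1) \sum_(0 <= i < (r./2).+1 | (i <= k <= r - i)%N)
   connection_term k (r - k) i * w ^+ k).
  rewrite big_mkord; apply: eq_bigr => -[k /=]; rewrite ltnS => le_kr _.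
  rewrite -connection_sumE ?subnKC //; last 2 first.
  - exact: qpoch_neq0_le qr0.
  - exact: qpoch_neq0_le (leq_subr _ _) qr0.
  rewrite /connection_sum mulr_suml.
  rewrite -(big_mkord xpredT (fun i => connection_term k (r - k) i * w ^+ k)).
  rewrite (big_nat_widen _ _ (r./2).+1) /=; last by lia.
  by apply: congr_big_nat => // i; lia.
rewrite (exchange_big_dep_nat xpredT) //= big_mkord.
apply: eq_bigr => -[i /=]; rewrite ltnS => le_ir _.
rewrite mulr_sumr.
rewrite -(big_mkord xpredT (fun k => _ * (rogers_coef q b k (r - 2 * i - k) * w ^+ k))).
(* For fixed [i], shifting [k] by [i] gives the Rogers polynomial of degree [r - 2 * i]. *)
transitivity (\sum_(i <= k < (r - i).+1) connection_term k (r - k) i * w ^+ k).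
  rewrite [RHS](big_nat_widen _ _ r.+1); last by lia.
  rewrite [RHS](big_nat_widenl _ 0) //.
  by apply: congr_big_nat => // k; lia.
rewrite -[X in index_iota X _]add0n big_addn.
rewrite [((r - i).+1 - i)%N](_ : _ = (r - 2 * i).+1); last by lia.
apply: eq_big_nat => k /= lt_k.
rewrite /connection_term subnKC; last by lia.
rewrite addnK [(r - (k + i) - i)%N](_ : _ = r - 2 * i - k)%N; last by lia.
by rewrite exprD; ring.
Qed.

End RogersConnection.

(** * From the connection formula back to the 2phi1 series *)

Theorem theorem1 (F : fieldType) (q u v x y : F) (r : nat)
  (hq : q != 0) (hu : u != 0) (hx : x != 0) (hy : y != 0)
  (hqr : qpoch q q r != 0)
  (hux : qpoch (q ^ (1 - r%:Z) / (u * x)) q r != 0)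
  (huy : qpoch (q ^ (1 - r%:Z) / (u * y)) q r != 0) :
  qpoch u q r / qpoch q q r
  * qhyp [tuple q ^ (- r%:Z); u * x] [tuple q ^ (1 - r%:Z) / (u * x)]
      q (q * v / (u ^+ 2 * x))
  = \sum_(i < (r./2).+1)
      qpoch u q (r - 2 * i)%N / qpoch q q (r - 2 * i)%N
      * qhyp [tuple q ^ (2 * i%:Z - r%:Z); u * y]
          [tuple q ^ (1 + 2 * i%:Z - r%:Z) / (u * y)]
          q (q * v / (u ^+ 2 * y))
      * (y ^+ i * v ^+ i)
      * (qpoch (x / y) q i / qpoch q q i)
      * (qpoch (u * q ^+ (r - 2 * i)) q (2 * i)%N
         / (qpoch (u * x * q ^+ (r - i)) q i
            * qpoch (u * y * q ^+ (r - 2 * i + 1)) q i)).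
Proof.
have a0 : u * x != 0 by rewrite mulf_neq0.
have b0 : u * y != 0 by rewrite mulf_neq0.
have ar0 : qpoch (u * x) q r != 0 by rewrite -qpoch_reverse_neq0.
have br0 : qpoch (u * y) q r != 0 by rewrite -qpoch_reverse_neq0.
(* Both arguments yield the same variable [v / u], so one connection formula applies. *)
have argE z : z != 0 -> q * v / (u ^+ 2 * z) = q * (v / u) / (u * z).
  by move=> z0; field; rewrite z0 hu.
rewrite !argE // qhyp_rogers // (rogers_connection (u * x) (v / u) hqr br0).
rewrite !mulr_sumr; apply: eq_bigr => -[i /=]; rewrite ltnS => le_ir _.
have le2 : (2 * i <= r)%N by clear -le_ir; lia.
have -> : 2 * i%:Z - r%:Z = - (r - 2 * i)%N%:Z by clear -le_ir; lia.
have -> : 1 + 2 * i%:Z - r%:Z = 1 - (r - 2 * i)%N%:Z by clear -le_ir; lia.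
have qi0 : qpoch q q i != 0 by apply: qpoch_neq0_le hqr; clear -le_ir; lia.
have q2i0 := qpoch_neq0_le (leq_subr (2 * i) r) hqr.
have b2i0 := qpoch_neq0_le (leq_subr (2 * i) r) br0.
rewrite qhyp_rogers //.
have xyE : u * x / (u * y) = x / y by field; rewrite hu hy.
rewrite homog_qpochE // xyE expr_div_n exprMn.
have uE := qpochD q u (r - 2 * i) (2 * i); rewrite subnK // in uE.
have aE := qpochD q (u * x) (r - i) i; rewrite subnK in aE; last by clear -le_ir; lia.
rewrite addn1 uE /vwp_denom.
have ui0 : u ^+ i != 0 by rewrite expf_neq0.
have bi0 : qpoch (u * y * q ^+ (r - 2 * i).+1) q i != 0.
  (* For [i = 0] the embedding into [qpoch (u * y) q r] would need length [r + 1]; the factorial is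
     then empty. *)
  have [->|i0] := posnP i; first by rewrite qpoch0 oner_eq0.
  have le_r : ((r - 2 * i).+1 + i <= r)%N by clear -le_ir i0; lia.
  by have := qpoch_neq0_le le_r br0; rewrite qpochD mulf_eq0 negb_or => /andP[].
move: ar0; rewrite aE mulf_eq0 negb_or => /andP[a10 a20].
by field; rewrite hqr qi0 q2i0 b2i0 ui0 bi0 a10 a20.
Qed.
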